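(* The genus-2 topological recursion relation $$\text{(I)}\qquad \langle\langle T^2(\mathcal{W})\rangle\rangle_2=A_1(\mathcal{W})\quad\text{for all vector fields }\mathcal{W}\text{ on the big phase space}$$ is a formal consequence of the genus-2 topological recursion relation $$\text{(II)}\qquad \langle\langle T(\mathcal{W})\,T(\mathcal{V})\rangle\rangle_2-3\langle\langle T(\mathcal{W}\bullet\mathcal{V})\rangle\rangle_2=A_2(\mathcal{W},\mathcal{V})\quad\text{for all vector fields }\mathcal{W},\mathcal{V}.$$ That is, if (II) holds for all $\mathcal{W},\mathcal{V}$, then (I) holds for all $\mathcal{W}$.
   Context: $V$ is a smooth projective variety with $H^{\rm odd}(V;\mathbb{C})=0$; $\gamma_1,\dots,\gamma_N$ is a basis of $H^*(V;\mathbb{C})$ with $\gamma_1$ the identity of the ordinary cohomology ring; $\eta_{\alpha\beta}=\int_V\gamma_\alpha\cup\gamma_\beta$, $(\eta^{\alpha\beta})=(\eta_{\alpha\beta})^{-1}$, $\gamma^\alpha=\eta^{\alpha\beta}\gamma_\beta$; repeated indices are summed. $F_g=\sum_{k\ge0}\frac1{k!}\sum t^{\alpha_1}_{n_1}\cdots t^{\alpha_k}_{n_k}\langle\tau_{n_1}(\gamma_{\alpha_1})\cdots\tau_{n_k}(\gamma_{\alpha_k})\rangle_g$ is the generating function of genus-$g$ descendant Gromov-Witten invariants, a formal power series in the coordinates $t^\alpha_n$ ($n\ge0$) of the big phase space; $\tilde t^\alpha_m=t^\alpha_m-\delta_{m,1}\delta_{\alpha,1}$. $\tau_n(\gamma_\alpha)$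 is identified with $\partial/\partial t^\alpha_n$; $\gamma_\alpha=\tau_0(\gamma_\alpha)$, $\tau_n(\gamma_\alpha)=0$ for $n<0$. For (formal) vector fields $\mathcal{W}_i=\sum f^i_{m,\alpha}\tau_m(\gamma_\alpha)$, $\langle\langle\mathcal{W}_1\cdots\mathcal{W}_k\rangle\rangle_g=\sum f^1_{m_1,\alpha_1}\cdots f^k_{m_k,\alpha_k}\frac{\partial^kF_g}{\partial t^{\alpha_1}_{m_1}\cdots\partial t^{\alpha_k}_{m_k}}$. Quantum product: $\mathcal{U}\bullet\mathcal{W}=\langle\langle\mathcal{U}\,\mathcal{W}\,\gamma^\alpha\rangle\rangle_0\gamma_\alpha$. For $\mathcal{W}=\sum f_{m,\alpha}\tau_m(\gamma_\alpha)$: $T(\mathcal{W})=\sum f_{m,\alpha}\tau_{m+1}(\gamma_\alpha)-\langle\langle\mathcal{W}\,\gamma^\alpha\rangle\rangle_0\gamma_\alpha$, and $T^2(\mathcal{W})=T(T(\mathcal{W}))$. ''Formal consequence'' is meant relative to the universal properties of the $F_g$ of lower complexity: the string equation $\langle\langle\mathcal{S}\rangle\rangle_g=\frac12\delta_{g,0}\eta_{\alpha\beta}t^\alpha_0t^\beta_0$ with $\mathcal{S}=-\sum\tilde t^\alpha_m\tau_{m-1}(\gamma_\alpha)$; the dilaton equation $\langle\langle\mathcal{D}\rangle\rangle_g=(2g-2)F_g+\frac1{24}\chi(V)\delta_{g,1}$ with $\mathcal{D}=-\sum\tilde t^\alpha_m\tau_m(\gamma_\alpha)$; the genus-0 topological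 recursion relation $T(\mathcal{W})\bullet\mathcal{V}=0$ for all $\mathcal{W},\mathcal{V}$ (which implies associativity of $\bullet$); and the genus-1 topological recursion relation $\langle\langle T(\mathcal{W})\rangle\rangle_1=\frac1{24}\langle\langle\mathcal{W}\,\gamma^\mu\,\gamma_\mu\rangle\rangle_0$. The tensors $A_1,A_2$, which involve only genus-0 and genus-1 data: $A_1(\mathcal{W})=\frac7{10}\langle\langle\gamma_\alpha\rangle\rangle_1\langle\langle\{\gamma^\alpha\bullet\mathcal{W}\}\rangle\rangle_1+\frac1{10}\langle\langle\gamma_\alpha\,\{\gamma^\alpha\bullet\mathcal{W}\}\rangle\rangle_1-\frac1{240}\langle\langle\mathcal{W}\,\{\gamma_\alpha\bullet\gamma^\alpha\}\rangle\rangle_1+\frac{13}{240}\langle\langle\mathcal{W}\,\gamma_\alpha\,\gamma^\alpha\,\gamma^\beta\rangle\rangle_0\langle\langle\gamma_\beta\rangle\rangle_1+\frac1{960}\langle\langle\mathcal{W}\,\gamma^\alpha\,\gamma_\alpha\,\gamma^\beta\,\gamma_\beta\rangle\rangle_0$. $A_2(\mathcal{W},\mathcal{V})=\frac{13}{10}\langle\langle\mathcal{W}\,\mathcal{V}\,\gamma^\alpha\,\gamma^\beta\rangle\rangle_0\langle\langle\gamma_\alpha\rangle\rangle_1\langle\langle\gamma_\beta\rangle\rangle_1+\frac45\langle\langle\mathcal{W}\,\gamma^\alpha\rangle\rangle_1\langle\langle\{\gamma_\alpha\bullet\mathcal{V}\}\rangle\rangle_1+\frac45\langle\langle\mathcal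{V}\,\gamma^\alpha\rangle\rangle_1\langle\langle\{\gamma_\alpha\bullet\mathcal{W}\}\rangle\rangle_1-\frac45\langle\langle\{\mathcal{W}\bullet\mathcal{V}\}\,\gamma^\alpha\rangle\rangle_1\langle\langle\gamma_\alpha\rangle\rangle_1+\frac{23}{240}\langle\langle\mathcal{W}\,\mathcal{V}\,\gamma^\alpha\,\gamma_\alpha\,\gamma^\beta\rangle\rangle_0\langle\langle\gamma_\beta\rangle\rangle_1+\frac1{48}\langle\langle\mathcal{W}\,\gamma^\alpha\,\gamma_\alpha\,\gamma^\beta\rangle\rangle_0\langle\langle\gamma_\beta\,\mathcal{V}\rangle\rangle_1+\frac1{48}\langle\langle\mathcal{V}\,\gamma^\alpha\,\gamma_\alpha\,\gamma^\beta\rangle\rangle_0\langle\langle\gamma_\beta\,\mathcal{W}\rangle\rangle_1-\frac1{80}\langle\langle\mathcal{W}\,\mathcal{V}\,\{\gamma^\alpha\bullet\gamma_\alpha\}\rangle\rangle_1+\frac7{30}\langle\langle\mathcal{W}\,\mathcal{V}\,\gamma^\alpha\,\gamma^\beta\rangle\rangle_0\langle\langle\gamma_\alpha\,\gamma_\beta\rangle\rangle_1+\frac1{30}\langle\langle\gamma_\alpha\,\{\gamma^\alpha\bullet\mathcal{W}\}\,\mathcal{V}\rangle\rangle_1+\frac1{30}\langle\langle\gamma_\alpha\,\{\gamma^\alpha\bullet\mathcal{V}\}\,\mathcal{W}\rangle\rangle_1-\frac1{30}\langle\langle\{\mathcal{W}\bullet\mathcal{V}\}\,\gamma_\alpha\,\gamma^\alpha\rangle\rangle_1+\frac1{576}\langle\langle\mathcal{W}\,\mathcal{V}\,\gamma^\alpha\,\gamma_\alpha\,\gamma^\beta\,\gamma_\beta\rangle\rangle_0$.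 *)

(* Defs.v *)
From HB Require Import structures.
From mathcomp Require Import all_boot all_order ssralg ssrnum matrix.
From mathcomp Require Import finmap multiset complex.
From mathcomp Require Import boolp classical_sets functions cardinality fsbigop.
From mathcomp Require Import reals.
Set Implicit Arguments.
Unset Strict Implicit.
Unset Printing Implicit Defensive.
Import GRing.Theory Num.Theory.
Local Open Scope mset_scope.
Local Open Scope classical_set_scope.
Local Open Scope ring_scope.

(* Formal power series over K in the (possibly infinitely many) variables
   t_p, p : I.  The multiset a : {mset I} encodes the monomial
   \prod_p t_p ^ (a p), and f@_a is its plain coefficient (no factorials). *)
Record series (I : choiceType) (K : comNzRingType) :=
  Series { coefm : {mset I} -> K }.

Notation "f @_ a" := (coefm f a)
  (at level 3, a at level 2, left associativity, format "f @_ a") : ring_scope.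

Section Series.
Variables (I : choiceType) (K : comNzRingType).
Implicit Types (a b c d : {mset I}) (f g h : series I K).

HB.instance Definition _ := gen_eqMixin (series I K).
HB.instance Definition _ := gen_choiceMixin (series I K).

Lemma seriesP f g : (forall a, f@_a = g@_a) -> f = g.
Proof. by case: f g => [f] [g] /= /funext ->. Qed.

Definition series_zero := @Series I K (fun=> 0).
Definition series_add f g := @Series I K (fun a => f@_a + g@_a).
Definition series_opp f := @Series I K (fun a => - f@_a).
Definition series_one := @Series I K (fun a => (a == mset0)%:R).
Definition series_scale (k : K) f := @Series I K (fun a => k * f@_a).
Definition series_mul f g := @Series I K (fun a =>
  \sum_(b \in [set b : {mset I} | (b `<=` a)%mset]) f@_b * g@_(a `\` b)%mset).

Fact series_addA : associative series_add.
Proof. by move=> f g h; apply/seriesP => a /=; rewrite addrA. Qed.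
Fact series_addC : commutative series_add.
Proof. by move=> f g; apply/seriesP => a /=; rewrite addrC. Qed.
Fact series_add0 : left_id series_zero series_add.
Proof. by move=> f; apply/seriesP => a /=; rewrite add0r. Qed.
Fact series_addN : left_inverse series_zero series_opp series_add.
Proof. by move=> f; apply/seriesP => a /=; rewrite addNr. Qed.

HB.instance Definition _ := GRing.isZmodule.Build (series I K)
  series_addA series_addC series_add0 series_addN.

Definition divisors_m a : seq {mset I} :=
  undup [seq seq_mset (mask (val m) a) | m : (size a).-tuple bool].

Lemma mem_divisors_m a b : (b \in divisors_m a) = (b `<=` a)%mset.
Proof.
rewrite mem_undup; apply/fintype.imageP/idP => [[m _ ->]|].
  apply/msubsetP => x; rewrite mset_seqE -(count_mem_mset x a).
  exact/leq_count_subseq/mask_subseq.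
move=> /msubsetP ba.
have /count_subseqP[s /subseqP[m sm ->] /eq_seq_msetP] :
    forall x, (count_mem x b <= count_mem x a)%N.
  by move=> x; rewrite !count_mem_mset.
by rewrite seq_mset_id => ->; exists (tcast sm (in_tuple m)) => //=; rewrite val_tcast.
Qed.

Lemma series_mulE f g a :
  (series_mul f g)@_a = \sum_(b <- divisors_m a) f@_b * g@_(a `\` b)%mset.
Proof.
rewrite /= (fsbig_fwiden (divisors_m a)) ?undup_uniq //.
  by move=> b /=; rewrite mem_divisors_m.
by move=> b [/=]; rewrite mem_divisors_m.
Qed.

Lemma msetBK a b : (b `<=` a)%mset -> (b `+` (a `\` b))%mset = a.
Proof.
by move=> /msubsetP ba; apply/msetP => x; rewrite !msetE2 subnKC.
Qed.

Lemma msetDK b c : ((b `+` c) `\` b)%mset = c.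
Proof. by apply/msetP => x; rewrite !msetE2 addKn. Qed.

Lemma msubsetDl a b : (a `<=` a `+` b)%mset.
Proof. by apply/msubsetP => x; rewrite msetE2 leq_addr. Qed.

(* A symmetric form, over any finite range D containing the divisors of a. *)
Lemma series_mulE2 (D : seq {mset I}) f g a : uniq D ->
  {subset divisors_m a <= D} ->
  (series_mul f g)@_a =
  \sum_(b <- D) \sum_(c <- D) if (b `+` c == a)%mset then f@_b * g@_c else 0.
Proof.
move=> uD sD; rewrite series_mulE.
have -> : \sum_(b <- divisors_m a) f@_b * g@_(a `\` b)%mset =
          \sum_(b <- D | (b `<=` a)%mset) f@_b * g@_(a `\` b)%mset.
  rewrite -[RHS]big_filter; apply/perm_big/uniq_perm.
  - exact: undup_uniq.
  - exact: filter_uniq.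
  move=> b; rewrite mem_filter -mem_divisors_m.
  by case: (boolP (b \in divisors_m a)) => // /sD ->.
rewrite big_mkcond /=; apply: eq_bigr => b _.
case: ifPn => ba; last first.
  rewrite big1_seq // => c _; case: eqP => // e.
  by rewrite -e msubsetDl in ba.
have cD : (a `\` b)%mset \in D.
  by apply: sD; rewrite mem_divisors_m; apply/msubsetP => x; rewrite msetE2 leq_subr.
rewrite (bigD1_seq (a `\` b)%mset) //= msetBK // eqxx big1_seq ?addr0 //.
move=> c /andP[ca _]; case: eqP => // e.
by rewrite -e msetDK eqxx in ca.
Qed.

Lemma divisors_mS a b : (b `<=` a)%mset -> {subset divisors_m b <= divisors_m a}.
Proof.
by move=> ba c; rewrite !mem_divisors_m => /msubset_trans; apply.
Qed.

Fact series_mulC : commutative series_mul.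
Proof.
move=> f g; apply/seriesP => a.
rewrite !(@series_mulE2 (divisors_m a)) ?undup_uniq // exchange_big /=.
apply: eq_bigr => b _; apply: eq_bigr => c _.
by rewrite msetDC mulrC.
Qed.

Lemma series_mulAE f g h a : (series_mul (series_mul f g) h)@_a =
  \sum_(b <- divisors_m a) \sum_(c <- divisors_m a) \sum_(d <- divisors_m a)
    if (b `+` c `+` d == a)%mset then f@_b * g@_c * h@_d else 0.
Proof.
set D := divisors_m a; have uD : uniq D by exact: undup_uniq.
rewrite (@series_mulE2 D) //.
transitivity (\sum_(x <- D) \sum_(d <- D) \sum_(b <- D) \sum_(c <- D)
    if (b `+` c == x)%mset && (x `+` d == a)%mset
    then f@_b * g@_c * h@_d else 0).
  apply: eq_big_seq => x xD; apply: eq_bigr => d _.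
  case: ifPn => e; last first.
    by rewrite big1 // => b _; rewrite big1 // => c _; rewrite andbF.
  rewrite (@series_mulE2 D) //; last first.
    by apply: divisors_mS; rewrite -mem_divisors_m.
  rewrite mulr_suml; apply: eq_bigr => b _.
  rewrite mulr_suml; apply: eq_bigr => c _.
  by rewrite andbT; case: ifP; rewrite ?mul0r.
rewrite exchange_big /=.
under eq_bigr do rewrite exchange_big /=.
rewrite exchange_big /=; apply: eq_bigr => b _.
under eq_bigr do rewrite exchange_big /=.
rewrite exchange_big /=; apply: eq_bigr => c _; apply: eq_bigr => d _.
have [e|e] := ifPn; last first.
  rewrite big1 // => x _; case: ifP => // /andP[/eqP <-].
  by rewrite (negbTE e).
rewrite (bigD1_seq (b `+` c)%mset) //=.
  rewrite eqxx e big1 ?addr0 // => x xn.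
  by rewrite eq_sym (negbTE xn).
by rewrite mem_divisors_m -(eqP e) msubsetDl.
Qed.

Fact series_mulA : associative series_mul.
Proof.
move=> f g h; apply/seriesP => a.
rewrite series_mulC !series_mulAE.
under eq_bigr do rewrite exchange_big /=.
rewrite exchange_big /=.
under eq_bigr do under eq_bigr do under eq_bigr do rewrite msetDC msetDA.
under eq_bigr do under eq_bigr do under eq_bigr do rewrite mulrC mulrA.
rewrite exchange_big /=.
under eq_bigr do rewrite exchange_big /=.
by rewrite exchange_big.
Qed.

Fact series_mul1 : left_id series_one series_mul.
Proof.
move=> f; apply/seriesP => a; rewrite series_mulE.
rewrite (bigD1_seq (mset0 : {mset I})) ?undup_uniq ?mem_divisors_m ?msub0set //=.
rewrite eqxx mul1r big1 ?addr0; last by move=> b /negbTE ->; rewrite mul0r.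
by congr (f@_ _); apply/msetP => x; rewrite msetE2 mset0E subn0.
Qed.

Fact series_mulDl : left_distributive series_mul series_add.
Proof.
move=> f g h; apply/seriesP => a; rewrite [RHS]/= -/(series_mul f h) -/(series_mul g h).
rewrite -[X in _ = X + _]/((series_mul f h)@_a) -[X in _ = _ + X]/((series_mul g h)@_a).
by rewrite !series_mulE -big_split; apply: eq_bigr => b _ /=; rewrite mulrDl.
Qed.

Fact series_one_neq0 : series_one != 0.
Proof.
apply/eqP => /(congr1 (fun f => f@_mset0)) /=.
by rewrite eqxx; apply/eqP; rewrite oner_eq0.
Qed.

HB.instance Definition _ := GRing.Zmodule_isComNzRing.Build (series I K)
  series_mulA series_mulC series_mul1 series_mulDl series_one_neq0.

Fact series_scaleA k l f : series_scale k (series_scale l f) = series_scale (k * l) f.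
Proof. by apply/seriesP => a /=; rewrite mulrA. Qed.
Fact series_scale1 : left_id 1 series_scale.
Proof. by move=> f; apply/seriesP => a /=; rewrite mul1r. Qed.
Fact series_scaleDr : right_distributive series_scale +%R.
Proof. by move=> k f g; apply/seriesP => a /=; rewrite mulrDr. Qed.
Fact series_scaleDl f : {morph series_scale^~ f : k l / k + l}.
Proof. by move=> k l; apply/seriesP => a /=; rewrite mulrDl. Qed.

HB.instance Definition _ := GRing.Zmodule_isLmodule.Build K (series I K)
  series_scaleA series_scale1 series_scaleDr series_scaleDl.

Fact series_scaleAl k f g : k *: (f * g) = (k *: f) * g.
Proof.
apply/seriesP => a; rewrite [LHS]/= -[X in k * X]/((series_mul f g)@_a).
rewrite series_mulE [RHS]series_mulE mulr_sumr.
by apply: eq_bigr => b _ /=; rewrite mulrA.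
Qed.

HB.instance Definition _ := GRing.Lmodule_isLalgebra.Build K (series I K)
  series_scaleAl.
HB.instance Definition _ := GRing.Lalgebra_isComAlgebra.Build K (series I K).

Definition svar (p : I) : series I K := Series (fun a => (a == [mset p])%:R).

Definition pderiv (p : I) f : series I K :=
  Series (fun a => (a p).+1%:R * f@_(p +` a)).

(* Coefficientwise sum of a possibly infinite family; on coefficients that
   receive infinitely many nonzero contributions it defaults to 0, a case that
   never arises below thanks to vsum_finite. *)
Definition ssum (G : I -> series I K) : series I K :=
  Series (fun a => \sum_(p \in [set: I]) (G p)@_a).

(* A formal vector field \sum_p f_p d/dt_p is the family of its components
   f_p, and a family of components is legitimate when each monomial occurs in
   finitely many of them: this is what makes \sum_p f_p G_p well defined for
   every family of series G_p. *)
Definition vfield := I -> series I K.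

Definition locally_finite (W : vfield) :=
  forall a, finite_set [set p | (W p)@_a != 0].

Lemma vsum_finite (W : vfield) (G : I -> series I K) a : locally_finite W ->
  finite_set [set p | (W p * G p)@_a != 0].
Proof.
move=> Wf; apply: (@sub_finite_set _ _
  (\bigcup_(b in [set b | b \in divisors_m a]) [set p | (W p)@_b != 0])).
  move=> p /= H; apply: contrapT => N; move/eqP: H; apply.
  rewrite [LHS]series_mulE big1_seq // => b /andP[_ ba].
  have [->|W0] := eqVneq ((W p)@_b) 0; first by rewrite mul0r.
  by exfalso; apply: N; exists b.
by apply: bigcup_finite => [|b _]; [exact: finite_seq | exact: Wf].
Qed.

End Series.

(* The bracket <<W_1 ... W_k>>_g is corr (F g) [:: W_1; ...; W_k]: the sum over
   (p_1, ..., p_k) of W_1 p_1 * ... * W_k p_k times the iterated partial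
   derivative of F g.  The components of the W_i are not differentiated. *)
Fixpoint corr (I : choiceType) (K : comNzRingType) (Fg : series I K)
    (Ws : seq (vfield I K)) : series I K :=
  if Ws is W :: Ws' then ssum (fun p => W p * corr (pderiv p Fg) Ws') else Fg.

(* The big phase space of a target with n.+1-dimensional cohomology: the
   variable svar C (m, a) is t^a_m, and gamma_a for a = ord0 is the identity.
   eta is the Poincare pairing and F g the genus-g descendant potential. *)
Section BigPhaseSpace.
Variables (R : realType) (n : nat).
Local Notation C := (R[i]).
Local Notation idx := (nat * 'I_n.+1)%type.
Local Notation vf := (vfield idx C).
Variables (eta : 'M[C]_n.+1) (F : nat -> series idx C).
Implicit Types (U V W : vf) (a b : 'I_n.+1).

Local Notation "'<<' x ; .. ; y '>>_' g" :=
  (corr (F g) (@cons vf x .. (@cons vf y (@nil vf)) ..))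
  (at level 0, x at level 99, y at level 99, g at level 2).

Definition ttilde (p : idx) : series idx C := svar C p - (p == (1%N, ord0))%:R.

Definition tau (m : nat) a : vf := fun p => (p == (m, a))%:R.

Definition gam a : vf := tau 0 a.

Definition gamup a : vf := \sum_b invmx eta a b *: gam b.

(* S = - \sum ttilde^a_m tau_(m-1)(gamma_a), where tau_(-1) = 0. *)
Definition string_vf : vf := fun p => - ttilde (p.1.+1, p.2).

Definition dilaton_vf : vf := fun p => - ttilde p.

Definition string_eq g := << string_vf >>_g =
  if g == 0%N then
    2^-1 *: \sum_a \sum_b eta a b *: (svar C (0%N, a) * svar C (0%N, b))
  else 0.

(* Since the odd cohomology vanishes, the Euler characteristic of the target
   is the dimension n.+1 of its cohomology. *)
Definition dilaton_eq g := << dilaton_vf >>_g =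
  ((2 * g)%:R - 2) *: F g +
  (if g == 1%N then (24^-1 * n.+1%:R) *: 1 else 0).

Definition qprod U W : vf :=
  fun p => \sum_a << U; W; gamup a >>_0 * gam a p.

Definition tau_shift W : vf :=
  fun p => if p.1 is m.+1 then W (m, p.2) else 0.

Definition T W : vf :=
  fun p => tau_shift W p - \sum_a << W; gamup a >>_0 * gam a p.

Definition trr0 := forall W V, locally_finite W -> locally_finite V ->
  qprod (T W) V = 0.

Definition trr1 := forall W, locally_finite W ->
  << T W >>_1 = 24^-1 *: \sum_a << W; gamup a; gam a >>_0.

Definition A1 W : series idx C :=
    (7 / 10) *: (\sum_a << gam a >>_1 * << qprod (gamup a) W >>_1)
  + (1 / 10) *: (\sum_a << gam a; qprod (gamup a) W >>_1)
  - (1 / 240) *: (\sum_a << W; qprod (gam a) (gamup a) >>_1)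
  + (13 / 240) *: (\sum_a \sum_b
      << W; gam a; gamup a; gamup b >>_0 * << gam b >>_1)
  + (1 / 960) *: (\sum_a \sum_b
      << W; gamup a; gam a; gamup b; gam b >>_0).

Definition A2 W V : series idx C :=
    (13 / 10) *: (\sum_a \sum_b
      << W; V; gamup a; gamup b >>_0 * << gam a >>_1 * << gam b >>_1)
  + (4 / 5) *: (\sum_a << W; gamup a >>_1 * << qprod (gam a) V >>_1)
  + (4 / 5) *: (\sum_a << V; gamup a >>_1 * << qprod (gam a) W >>_1)
  - (4 / 5) *: (\sum_a << qprod W V; gamup a >>_1 * << gam a >>_1)
  + (23 / 240) *: (\sum_a \sum_b
      << W; V; gamup a; gam a; gamup b >>_0 * << gam b >>_1)
  + (1 / 48) *: (\sum_a \sum_b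
      << W; gamup a; gam a; gamup b >>_0 * << gam b; V >>_1)
  + (1 / 48) *: (\sum_a \sum_b
      << V; gamup a; gam a; gamup b >>_0 * << gam b; W >>_1)
  - (1 / 80) *: (\sum_a << W; V; qprod (gamup a) (gam a) >>_1)
  + (7 / 30) *: (\sum_a \sum_b
      << W; V; gamup a; gamup b >>_0 * << gam a; gam b >>_1)
  + (1 / 30) *: (\sum_a << gam a; qprod (gamup a) W; V >>_1)
  + (1 / 30) *: (\sum_a << gam a; qprod (gamup a) V; W >>_1)
  - (1 / 30) *: (\sum_a << qprod W V; gam a; gamup a >>_1)
  + (1 / 576) *: (\sum_a \sum_b
      << W; V; gamup a; gam a; gamup b; gam b >>_0).

Definition trr2_TT := forall W V, locally_finite W -> locally_finite V ->
  << T W; T V >>_2 - 3 *: << T (qprod W V) >>_2 = A2 W V.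

Definition trr2_T2 := forall W, locally_finite W -> << T (T W) >>_2 = A1 W.

End BigPhaseSpace.

(* Main.v *)
Require Import Defs.
From mathcomp Require Import all_boot ssralg ssrnum matrix complex reals.
From mathcomp Require Import finmap multiset boolp classical_sets functions.
From mathcomp Require Import cardinality fsbigop ring.
Set Implicit Arguments.
Unset Strict Implicit.
Unset Printing Implicit Defensive.
Import GRing.Theory Num.Theory.
Local Open Scope mset_scope.
Local Open Scope classical_set_scope.
Local Open Scope ring_scope.

(** Apply (II) to the string field S and to T(W).

    On the left-hand side, the string equation gives T(S) = D, the dilaton
    field ([T_string]); the dilaton equation then turns <<D T(T(W))>>_2 into
    3 <<T(T(W))>>_2 ([dilaton2]); and S . T(W) = 0 by the genus-0 recursion, so
    the second bracket vanishes.  Hence 3 <<T^2(W)>>_2 = A_2(S, T(W)), and what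
    remains is the identity A_2(S, T(W)) = 3 A_1(W) ([A2_string_T]), which
    involves genus 0 and genus 1 only.

    Three facts evaluate the thirteen terms of A_2(S, T(W)).
    - The string equation removes S.  A bracket whose entries are S and primary
      fields vanishes in positive genus, and in genus 0 from three primary
      entries on.  In a bracket containing S, a field X and primary fields (at
      least two of them in genus 0), S acts by lowering the descendant level of
      X by one ([string0_unshift], [stringS_unshift]); for X = T(W) the result
      of lowering is exactly W ([unshift_T]).
    - S is a unit for the quantum product on primary fields ([qprod_string]),
      and the product of T(W) with any field is 0.
    - The remaining genus-1 brackets with an entry T(W) and one or two primary
      entries are obtained by differentiating the genus-1 recursion once or
      twice along constant fields ([trr1_deriv1], [trr1_deriv2]).
    After this every term is a multiple of one of the five tensors occurring in
    A_1(W), and the coefficients agree ([A2_combination]).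

    The bracket does not differentiate the components of its entries, so a
    derivative of a bracket is a bracket with one more entry plus corrections
    where an entry is differentiated.  The corrections are controlled by two
    cases: entries with constant components ([flat]), for which there are none,
    and S and D, whose components are affine in the coordinates
    ([corr_affine_cons]).

    All sums over the coordinates are infinite.  They are handled by
    truncation: below a fixed monomial a locally finite family is supported on
    a finite list ([lf_supported]), which reduces interchange of summations and
    termwise differentiation to finite sums. *)

(** * Formal partial derivatives *)

Section Calculus.
Variables (I : choiceType) (K : comNzRingType).
Implicit Types (a b : {mset I}) (f g h : series I K) (p q : I).
Implicit Types (U V W : vfield I K).

Lemma coefmD f g a : (f + g)@_a = f@_a + g@_a. Proof. by []. Qed.

Lemma coefm_sum (J : Type) (s : seq J) (G : J -> series I K) a :
  (\sum_(i <- s) G i)@_a = \sum_(i <- s) (G i)@_a.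
Proof. by elim/big_ind2: _ => // f x g y <- <-. Qed.

Lemma coefmM f g a :
  (f * g)@_a = \sum_(b <- divisors_m a) f@_b * g@_(a `\` b)%mset.
Proof. exact: series_mulE. Qed.

Lemma pderivD p : {morph @pderiv I K p : f g / f + g}.
Proof. by move=> f g; apply/seriesP => a /=; rewrite mulrDr. Qed.

Lemma pderiv0 p : pderiv p (0 : series I K) = 0.
Proof. by apply/seriesP => a /=; rewrite mulr0. Qed.

Lemma pderivN p f : pderiv p (- f) = - pderiv p f.
Proof. by apply/seriesP => a /=; rewrite mulrN. Qed.

Lemma pderivZ p (k : K) f : pderiv p (k *: f) = k *: pderiv p f.
Proof. by apply/seriesP => a /=; rewrite mulrCA. Qed.

Lemma pderiv_sum p (J : Type) (s : seq J) (G : J -> series I K) :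
  pderiv p (\sum_(i <- s) G i) = \sum_(i <- s) pderiv p (G i).
Proof. by elim/big_rec2: _ => [|i f g _ <-]; rewrite ?pderiv0 ?pderivD. Qed.

Lemma pderivC p q f : pderiv p (pderiv q f) = pderiv q (pderiv p f).
Proof.
apply/seriesP => a /=; rewrite !mset1DE msetDA (msetDC [mset q]) -msetDA.
by case: eqVneq => [->//|_]; rewrite !add0n mulrCA.
Qed.

(** Both halves of the Leibniz rule become sums over the divisors of the same
    monomial: shifting the divisors of [a] by [p] reaches exactly the divisors
    of [p + a] that contain [p], and the weight [b p] kills the others. *)
Lemma pderiv_half p f g a : (pderiv p f * g)@_a =
  \sum_(b <- divisors_m (p +` a)%mset)
    (b p)%:R * (f@_b * g@_((p +` a) `\` b)%mset).
Proof.
rewrite coefmM; set D := divisors_m (p +` a)%mset.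
transitivity (\sum_(b <- [seq (p +` b)%mset | b <- divisors_m a])
    (b p)%:R * (f@_b * g@_((p +` a) `\` b)%mset)).
  rewrite big_map; apply: eq_bigr => b _ /=.
  rewrite mset1DE eqxx add1n mulrA; congr (_ * g@_ _).
  by apply/msetP => x; rewrite !msetE2 subnDl.
rewrite [RHS](bigID (fun b => p \in b)) /= [X in _ + X]big1 ?addr0; last first.
  by move=> b /mset_eq0P ->; rewrite mul0r.
rewrite -[RHS]big_filter; apply/perm_big/uniq_perm.
- rewrite map_inj_uniq ?undup_uniq // => b c e.
  by rewrite -[b](msetDK [mset p]) e msetDK.
- by rewrite filter_uniq ?undup_uniq.
move=> b; rewrite mem_filter mem_divisors_m; apply/mapP/andP.
  move=> [c]; rewrite mem_divisors_m => /msubsetP ca ->; split.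
    by rewrite in_mset1D eqxx.
  by apply/msubsetP => x; rewrite !mset1DE leq_add2l ca.
move=> [pb /msubsetP ba]; exists (b `\` [mset p])%mset.
  rewrite mem_divisors_m; apply/msubsetP => x; have := ba x.
  by rewrite mset1DE msetE2 msetnE leq_subLR; case: eqP.
by apply/esym/msetBK; rewrite msub1set.
Qed.

Lemma divisors_flip (G : {mset I} -> {mset I} -> K) a :
  \sum_(b <- divisors_m a) G b (a `\` b)%mset =
  \sum_(b <- divisors_m a) G (a `\` b)%mset b.
Proof.
have BK b : b \in divisors_m a -> (a `\` (a `\` b))%mset = b.
  rewrite mem_divisors_m => /msubsetP ba.
  by apply/msetP => x; rewrite !msetE2 subKn.
rewrite [RHS](eq_big_seq (fun b => G (a `\` b) (a `\` (a `\` b)))%mset);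
  last by move=> b /BK ->.
rewrite -(big_map (fun b => a `\` b)%mset xpredT (fun b => G b (a `\` b)%mset)).
apply/perm_big/uniq_perm; rewrite ?undup_uniq //.
  rewrite map_inj_in_uniq ?undup_uniq // => b c /BK {2}<- /BK {2}<- e.
  by rewrite e.
have Ba b : (a `\` b)%mset \in divisors_m a.
  by rewrite mem_divisors_m; apply/msubsetP => x; rewrite msetE2 leq_subr.
by move=> b; apply/idP/mapP => [/BK|[c _ ->//]]; exists (a `\` b)%mset.
Qed.

Lemma pderivM p f g : pderiv p (f * g) = pderiv p f * g + f * pderiv p g.
Proof.
apply/seriesP => a; rewrite coefmD [f * pderiv _ _]mulrC !pderiv_half.
rewrite [X in _ + X](divisors_flip (fun b c => (b p)%:R * (g@_b * f@_c))).
rewrite -big_split -[LHS]/((a p).+1%:R * (f * g)@_(p +` a)%mset) coefmM mulr_sumr.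
apply: eq_big_seq => b; rewrite mem_divisors_m => /msubsetP/(_ p) bp /=.
rewrite [g@_ _ * _]mulrC -mulrDl -natrD msetE2 subnKC //.
by rewrite mset1DE eqxx.
Qed.

(** * Locally finite families and their sums *)

(** Below the monomial [a], the family [G] lives on the list [D]. *)
Definition supported (G : I -> series I K) a (D : seq I) :=
  forall p b, (b `<=` a)%mset -> p \notin D -> (G p)@_b = 0.

Lemma supportedS (G : I -> series I K) a b (D E : seq I) :
  (b `<=` a)%mset -> {subset D <= E} -> supported G a D -> supported G b E.
Proof.
move=> ba DE GD p c cb pE; apply: GD; first exact: (msubset_trans cb ba).
by apply: contra pE; exact: DE.
Qed.

Lemma lf_supported (G : I -> series I K) : locally_finite G ->
  forall a, exists2 D, uniq D & supported G a D.
Proof.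
move=> Gf a; have fin : finite_set
    (\bigcup_(b in [set b | b \in divisors_m a]) [set p | (G p)@_b != 0]).
  by apply: bigcup_finite => [|b _]; [exact: finite_seq | exact: Gf].
have /finite_seqP[D eD] := fin.
exists (undup D); rewrite ?undup_uniq // => p b ba; rewrite mem_undup => pD.
apply/eqP; apply: contraNT pD => Gb.
have : [set` D] p by rewrite -eD; exists b; rewrite //= mem_divisors_m.
by [].
Qed.

Lemma supported_lf (G : I -> series I K) :
  (forall a, exists D, supported G a D) -> locally_finite G.
Proof.
move=> H a; have [D GD] := H a.
apply: (@sub_finite_set _ _ [set` D]); last exact: finite_seq.
by move=> p /=; apply: contraNT => /(GD p a (msubset_refl a)) ->.
Qed.

Lemma supportedM (G H : I -> series I K) a D : supported G a D ->
  supported (fun p => G p * H p) a D.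
Proof.
move=> GD p b ba pD; rewrite coefmM big1_seq // => c /andP[_].
rewrite mem_divisors_m => cb.
by rewrite (GD p c) ?mul0r // (msubset_trans cb).
Qed.

Lemma ssum_supported (G : I -> series I K) a D : uniq D -> supported G a D ->
  forall b, (b `<=` a)%mset -> (ssum G)@_b = (\sum_(p <- D) G p)@_b.
Proof.
move=> uD GD b ba; rewrite coefm_sum fsbig_seq //.
apply/esym/fsbig_widen => // p [_ /negP pD].
exact: (GD p b ba).
Qed.

Lemma lfM (G H : I -> series I K) : locally_finite G ->
  locally_finite (fun p => G p * H p).
Proof. by move=> Gf a; exact: vsum_finite. Qed.

Lemma lfMl (G H : I -> series I K) : locally_finite H ->
  locally_finite (fun p => G p * H p).
Proof.
move=> Hf; have := lfM G Hf.
by congr (@locally_finite I K); apply/funext => p; rewrite mulrC.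
Qed.

Lemma lfD (G H : I -> series I K) : locally_finite G -> locally_finite H ->
  locally_finite (fun p => G p + H p).
Proof.
move=> Gf Hf a; apply: (@sub_finite_set _ _
  ([set p | (G p)@_a != 0] `|` [set p | (H p)@_a != 0])).
  move=> p /= GH; apply: contrapT => /not_orP[/negP/negPn/eqP G0 /negP/negPn/eqP H0].
  by rewrite G0 H0 addr0 eqxx in GH.
by rewrite finite_setU.
Qed.

Lemma lfN (G : I -> series I K) : locally_finite G ->
  locally_finite (fun p => - G p).
Proof.
move=> Gf a; apply: sub_finite_set (Gf a) => p /=.
by rewrite oppr_eq0.
Qed.

Lemma lf_pderiv (G : I -> series I K) q : locally_finite G ->
  locally_finite (fun p => pderiv q (G p)).
Proof.
move=> Gf a; apply: sub_finite_set (Gf (q +` a)%mset) => p /=.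
by apply: contraNneq => ->; rewrite mulr0.
Qed.

Lemma lf_sum (J : Type) (s : seq J) (G : J -> I -> series I K) :
  (forall i, locally_finite (G i)) ->
  locally_finite (fun p => \sum_(i <- s) G i p).
Proof.
move=> Gf; elim: s => [|i s IH].
  apply: supported_lf => a; exists [::] => p b _ _.
  by rewrite big_nil.
have := lfD (Gf i) IH; congr (@locally_finite I K).
by apply/funext => p; rewrite big_cons.
Qed.

Lemma lf_delta q (h : series I K) : locally_finite (fun p => (p == q)%:R * h).
Proof.
apply: supported_lf => a; exists [:: q] => p b _.
by rewrite inE => /negPf ->; rewrite mul0r.
Qed.

Lemma ssumD (G H : I -> series I K) : locally_finite G -> locally_finite H ->
  ssum (fun p => G p + H p) = ssum G + ssum H.
Proof.
move=> Gf Hf; apply/seriesP => a.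
have [D _ GD] := lf_supported Gf a; have [E _ HE] := lf_supported Hf a.
have DE : {subset D <= undup (D ++ E)}.
  by move=> p pD; rewrite mem_undup mem_cat pD.
have ED : {subset E <= undup (D ++ E)}.
  by move=> p pD; rewrite mem_undup mem_cat pD orbT.
have GS := supportedS (msubset_refl a) DE GD.
have HS := supportedS (msubset_refl a) ED HE.
have GHS : supported (fun p => G p + H p) a (undup (D ++ E)).
  by move=> p b ba pD; rewrite coefmD GS ?HS // addr0.
have e := ssum_supported (undup_uniq _) _ (msubset_refl a).
by rewrite coefmD (e _ _ GHS) (e _ _ GS) (e _ _ HS) big_split.
Qed.

Lemma ssumZ h (G : I -> series I K) : locally_finite G ->
  h * ssum G = ssum (fun p => h * G p).
Proof.
move=> Gf; apply/seriesP => a; have [D uD GD] := lf_supported Gf a.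
have GS : supported (fun p => h * G p) a D.
  have := supportedM (fun=> h) GD.
  by congr (supported _ a D); apply/funext => p; rewrite mulrC.
rewrite (ssum_supported uD GS (msubset_refl a)) -mulr_sumr !coefmM.
apply: eq_big_seq => b; rewrite mem_divisors_m => ba.
congr (_ * _); apply: (ssum_supported uD GD).
by apply/msubsetP => x; rewrite msetE2 leq_subr.
Qed.

Lemma pderiv_ssum q (G : I -> series I K) : locally_finite G ->
  pderiv q (ssum G) = ssum (fun p => pderiv q (G p)).
Proof.
move=> Gf; apply/seriesP => a.
have [D uD GD] := lf_supported Gf (q +` a)%mset.
have GS : supported (fun p => pderiv q (G p)) a D.
  move=> p b /msubsetP ba pD /=; rewrite GD ?mulr0 //.
  by apply/msubsetP => x; rewrite !mset1DE leq_add2l ba.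
rewrite (ssum_supported uD GS (msubset_refl a)) -pderiv_sum.
by congr (_ * _); exact: ssum_supported uD GD _ (msubset_refl _).
Qed.

(** One pair of finite lists truncates a double sum in both directions at once.
    Local finiteness of [G q] need not be uniform in [q]: only the finitely many
    [q] that survive in [U] matter. *)
Lemma ssum_exchange_supported U (G : I -> I -> series I K) :
    locally_finite U -> (forall q, locally_finite (G q)) ->
  forall a, exists Dq Dp, [/\ uniq Dq, uniq Dp, supported U a Dq,
    (forall q, q \in Dq -> supported (G q) a Dp) &
    supported (fun p => ssum (fun q => U q * G q p)) a Dp].
Proof.
move=> Uf Gf a; have [Dq uDq UD] := lf_supported Uf a.
have /boolp.choice[E HE] : forall q, exists E, supported (G q) a E.
  by move=> q; have [E _ ?] := lf_supported (Gf q) a; exists E.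
pose Dp := undup (flatten [seq E q | q <- Dq]).
have GDp q : q \in Dq -> supported (G q) a Dp.
  move=> qD; apply: supportedS (msubset_refl a) _ (HE q) => p pE.
  by rewrite mem_undup; apply/flatten_mapP; exists q.
exists Dq, Dp; split; rewrite ?undup_uniq // => p b ba pD.
rewrite (ssum_supported uDq (supportedM _ UD) ba) coefm_sum big1_seq // => q /andP[_ qD].
rewrite mulrC; apply: (supportedM (fun=> U q) (GDp q qD)) => //.
Qed.

Lemma ssum_exchange U (G : I -> I -> series I K) :
    locally_finite U -> (forall q, locally_finite (G q)) ->
  ssum (fun q => U q * ssum (G q)) = ssum (fun p => ssum (fun q => U q * G q p)).
Proof.
move=> Uf Gf; apply/seriesP => a.
have [Dq [Dp [uDq uDp UD GD SD]]] := ssum_exchange_supported Uf Gf a.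
rewrite (ssum_supported uDq (supportedM _ UD) (msubset_refl a)).
rewrite (ssum_supported uDp SD (msubset_refl a)) !coefm_sum.
rewrite [RHS](eq_bigr (fun p => \sum_(q <- Dq) (U q * G q p)@_a)); last first.
  move=> p _; rewrite (ssum_supported uDq (supportedM _ UD) (msubset_refl a)).
  by rewrite coefm_sum.
rewrite exchange_big; apply: eq_big_seq => q qD.
rewrite ssumZ // (@ssum_supported _ a Dp) ?coefm_sum ?msubset_refl //.
have := supportedM (fun=> U q) (GD q qD).
by congr (supported _ a _); apply/funext => p; rewrite mulrC.
Qed.

Lemma lf_ssum U (G : I -> I -> series I K) :
    locally_finite U -> (forall q, locally_finite (G q)) ->
  locally_finite (fun p => ssum (fun q => U q * G q p)).
Proof.
move=> Uf Gf; apply: supported_lf => a.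
by have [Dq [Dp [_ _ _ _ SD]]] := ssum_exchange_supported Uf Gf a; exists Dp.
Qed.

Lemma ssum_delta q (H : I -> series I K) :
  ssum (fun p => (p == q)%:R * H p) = H q.
Proof.
apply/seriesP => a; rewrite (@ssum_supported _ a [:: q]) ?msubset_refl //.
  by rewrite big_seq1 eqxx mul1r.
by move=> p b _; rewrite inE => /negPf ->; rewrite mul0r.
Qed.

Lemma ssum0 : ssum (fun=> 0 : series I K) = 0.
Proof. by apply/seriesP => a /=; rewrite fsbig1. Qed.

End Calculus.

(** * Calculus of brackets *)

Section Brackets.
Variables (I : choiceType) (K : comNzRingType).
Implicit Types (f g h : series I K) (p q : I).
Implicit Types (U V W X Y : vfield I K) (Ws : seq (vfield I K)).

Fixpoint all_vf (P : vfield I K -> Prop) Ws : Prop :=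
  if Ws is W :: Ws' then P W /\ all_vf P Ws' else True.

(** Constant coefficients: the entries that commute with differentiation. *)
Definition flat U := forall q p, pderiv q (U p) = 0.

(** The flat connection of the big phase space, differentiating the components
    of [W] along [U]. *)
Definition nabla U W : vfield I K := fun p => corr (W p) [:: U].

Lemma lf_nabla U W : locally_finite U -> locally_finite W ->
  locally_finite (nabla U W).
Proof. by move=> Uf Wf; apply: lf_ssum => // q; exact: lf_pderiv. Qed.

Lemma corr0 Ws : corr (0 : series I K) Ws = 0.
Proof.
elim: Ws => //= W Ws IH; rewrite -[RHS](ssum0 I K); congr ssum.
by apply/funext => p; rewrite pderiv0 IH mulr0.
Qed.

Lemma corrD f g Ws : all_vf (@locally_finite I K) Ws ->
  corr (f + g) Ws = corr f Ws + corr g Ws.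
Proof.
elim: Ws f g => //= W Ws IH f g [Wf Wsf]; rewrite -ssumD; [|exact: lfM..].
by congr ssum; apply/funext => p; rewrite pderivD IH // mulrDr.
Qed.

Lemma corrZ (k : K) f Ws : all_vf (@locally_finite I K) Ws ->
  corr (k *: f) Ws = k *: corr f Ws.
Proof.
elim: Ws f => //= W Ws IH f [Wf Wsf].
rewrite -[RHS]mulr_algl ssumZ; last exact: lfM.
congr ssum; apply/funext => p.
by rewrite pderivZ IH // mulr_algl scalerAr.
Qed.

Lemma corr_sum (J : Type) (s : seq J) (f : J -> series I K) Ws :
  all_vf (@locally_finite I K) Ws ->
  corr (\sum_(i <- s) f i) Ws = \sum_(i <- s) corr (f i) Ws.
Proof.
by move=> Wsf; elim/big_rec2: _ => [|i y x _ <-]; rewrite ?corr0 ?corrD.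
Qed.

Lemma corr_swap f U V Ws : locally_finite U -> locally_finite V ->
  corr f [:: U, V & Ws] = corr f [:: V, U & Ws].
Proof.
move=> Uf Vf /=; rewrite ssum_exchange => [|//|q]; last exact: lfM.
congr ssum; apply/funext => p; rewrite ssumZ; last exact: lfM.
by congr ssum; apply/funext => q; rewrite mulrCA pderivC.
Qed.

Lemma corr_cons f W Ws Ws' : (forall g, corr g Ws = corr g Ws') ->
  corr f (W :: Ws) = corr f (W :: Ws').
Proof. by move=> e /=; congr ssum; apply/funext => p; rewrite e. Qed.

(** Brackets are tensorial: they are linear over series, not only over
    constants, because components are never differentiated. *)
Lemma corr_lincomb f (J : Type) (s : seq J) (h : J -> series I K)
    (V : J -> vfield I K) Ws : (forall i, locally_finite (V i)) ->
  corr f ((fun p => \sum_(i <- s) h i * V i p) :: Ws) =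
  \sum_(i <- s) h i * corr f (V i :: Ws).
Proof.
move=> Vf; elim: s => [|i s IH] /=.
  rewrite big_nil -[RHS](ssum0 I K); congr ssum.
  by apply/funext => p; rewrite big_nil mul0r.
rewrite big_cons -{}IH /= ssumZ -?ssumD.
- by congr ssum; apply/funext => p; rewrite big_cons mulrDl mulrA.
- exact/lfMl/lfM.
- by apply/lfM/lf_sum => j; exact: lfMl.
- exact: lfM.
Qed.

Lemma corrDl f U V Ws : locally_finite U -> locally_finite V ->
  corr f ((fun p => U p + V p) :: Ws) = corr f (U :: Ws) + corr f (V :: Ws).
Proof.
move=> Uf Vf /=; rewrite -ssumD; [|exact: lfM..].
by congr ssum; apply/funext => p; rewrite mulrDl.
Qed.

Lemma corrNl f U Ws : locally_finite U ->
  corr f ((fun p => - U p) :: Ws) = - corr f (U :: Ws).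
Proof.
move=> Uf /=; rewrite -mulN1r ssumZ; last exact: lfM.
by congr ssum; apply/funext => p; rewrite mulNr mulN1r.
Qed.

Lemma pderiv_corr q f Ys : all_vf (@locally_finite I K) Ys -> all_vf flat Ys ->
  pderiv q (corr f Ys) = corr (pderiv q f) Ys.
Proof.
elim: Ys f => //= Y Ys IH f [Yf Ysf] [Yc Ysc].
rewrite pderiv_ssum; last exact: lfM.
congr ssum; apply/funext => p.
by rewrite pderivM Yc mul0r add0r IH // pderivC.
Qed.

Lemma pderiv_corr_cons q f X Ys : locally_finite X ->
  all_vf (@locally_finite I K) Ys -> all_vf flat Ys ->
  pderiv q (corr f (X :: Ys)) =
  corr f ((fun p => pderiv q (X p)) :: Ys) + corr (pderiv q f) (X :: Ys).
Proof.
move=> Xf Ysf Ysc /=; rewrite pderiv_ssum; last exact: lfM.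
rewrite -ssumD; [|exact: (lfM _ (lf_pderiv q Xf))|exact: lfM].
congr ssum; apply/funext => p.
by rewrite pderivM pderiv_corr // pderivC.
Qed.

Lemma corr_ssum f U (G : I -> vfield I K) Ws : locally_finite U ->
  (forall q, locally_finite (G q)) ->
  ssum (fun q => U q * corr f (G q :: Ws)) =
  corr f ((fun p => ssum (fun q => U q * G q p)) :: Ws).
Proof.
move=> Uf Gf /=; have Gf' q : locally_finite (fun p => G q p * corr (pderiv p f) Ws).
  exact: lfM.
rewrite (ssum_exchange Uf Gf').
congr ssum; apply/funext => p; rewrite [RHS]mulrC ssumZ; last exact: (lfM _ Uf).
by congr ssum; apply/funext => q; rewrite [RHS]mulrC mulrA.
Qed.

(** Differentiating a bracket whose entries after the first are flat: only the
    components of the first entry are hit. *)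
Lemma corr_derive f U X Ys : locally_finite U -> locally_finite X ->
  all_vf (@locally_finite I K) Ys -> all_vf flat Ys ->
  corr (corr f (X :: Ys)) [:: U] =
  corr f (nabla U X :: Ys) + corr f [:: X, U & Ys].
Proof.
move=> Uf Xf Ysf Ysc.
transitivity (ssum (fun q => U q * corr f ((fun p => pderiv q (X p)) :: Ys) +
                             U q * corr (pderiv q f) (X :: Ys))).
  congr ssum; apply/funext => q /=.
  by rewrite -mulrDr -pderiv_corr_cons.
rewrite ssumD; [|exact: lfM..].
rewrite corr_ssum // => [|q]; last exact: lf_pderiv.
by rewrite [in RHS]corr_swap.
Qed.

Lemma corr_flat f U Ws : locally_finite U -> flat U ->
  all_vf (@locally_finite I K) Ws ->
  corr (corr f [:: U]) Ws = corr f (U :: Ws).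
Proof.
move=> Uf Uc; elim: Ws f => //= W Ws IH f [Wf Wsf].
rewrite -[RHS]/(corr f [:: U, W & Ws]) corr_swap //=.
congr ssum; apply/funext => p; rewrite -[ssum _]/(corr f [:: U]).
by rewrite pderiv_corr // IH.
Qed.

(** Inserting [S] in a bracket versus taking the bracket of the series
    <<S>>: the two differ by derivatives of the components of [S].  When these
    components are affine, the derivative is flat and the correction is a single
    bracket.  With [S] the string or the dilaton field this turns an equation
    for <<S>> into equations for all brackets containing [S]. *)
Lemma corr_affine_cons f S X Ys : locally_finite S -> locally_finite X ->
  (forall q, flat (fun p => pderiv q (S p))) ->
  all_vf (@locally_finite I K) Ys ->
  (forall g, corr (corr g [:: S]) Ys = corr g (S :: Ys)) ->
  corr (corr f [:: S]) (X :: Ys) =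
  corr f [:: S, X & Ys] + corr f (nabla X S :: Ys).
Proof.
move=> Sf Xf Sc Ysf e; have dSf q := lf_pderiv q Sf.
rewrite corr_swap // -corr_ssum // -ssumD; [|exact: lfM..].
congr ssum; apply/funext => q; rewrite -mulrDr; congr (_ * _).
transitivity (corr (corr f [:: fun p => pderiv q (S p)] +
                    corr (pderiv q f) [:: S]) Ys).
  by rewrite -pderiv_corr_cons.
by rewrite corrD // (corr_flat f (dSf q) (Sc q)) // e addrC.
Qed.

(** Directions along which [S] is constant produce no correction. *)
Lemma corr_affine f S Ys : locally_finite S ->
  (forall q, flat (fun p => pderiv q (S p))) ->
  all_vf (@locally_finite I K) Ys ->
  all_vf (fun Y => nabla Y S = fun=> 0) Ys ->
  corr (corr f [:: S]) Ys = corr f (S :: Ys).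
Proof.
move=> Sf Sc; elim: Ys f => // Y Ys IH f [Yf Ysf] [YS YsS].
rewrite corr_affine_cons // => [|g]; last exact: IH.
rewrite YS -[RHS]addr0; congr (_ + _) => /=.
by rewrite -[RHS](ssum0 I K); congr ssum; apply/funext => p; rewrite mul0r.
Qed.

Lemma pderiv_svar p q : pderiv p (svar K q) = (p == q)%:R.
Proof.
apply/seriesP => a; rewrite [LHS]/=.
have [->|pq] := eqVneq p q.
  rewrite -[RHS]/((1 : series I K)@_a) -[RHS]/((a == mset0)%:R).
  have [->|a0] := eqVneq a mset0; first by rewrite msetD0 eqxx mset0E mulr1.
  case: eqP => [e|_]; last by rewrite mulr0.
  case/eqP: a0; rewrite -[a](msetDK [mset q]) e.
  by apply/msetP => x; rewrite msetE2 mset0E subnn.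
rewrite -[RHS]/(0 : K); case: eqP => [/msetP/(_ p)|_]; last by rewrite mulr0.
by rewrite mset1DE eqxx msetnE (negPf pq).
Qed.

Local Opaque svar.

Lemma pderiv_nat p n : pderiv p (n%:R : series I K) = 0.
Proof.
have d1 : pderiv p (1 : series I K) = 0.
  have := pderivM p 1 (1 : series I K); rewrite !mulr1 mul1r.
  by rewrite -[LHS]addr0 => /addrI <-.
elim: n => [|n IH]; first exact: pderiv0.
by rewrite -addn1 natrD pderivD IH add0r.
Qed.

Lemma corr_rev3 f U V W Ys : locally_finite U -> locally_finite V -> locally_finite W ->
  corr f [:: U, V, W & Ys] = corr f [:: W, V, U & Ys].
Proof.
move=> Uf Vf Wf; rewrite corr_swap // (corr_cons _ _ (fun g => corr_swap g Ys Uf Wf)).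
exact: corr_swap.
Qed.

Lemma corr_0l f Ys : corr f ((fun=> 0) :: Ys) = 0.
Proof.
rewrite /= -[RHS](ssum0 I K); congr ssum.
by apply/funext => p; rewrite mul0r.
Qed.

Lemma corrM f g U : locally_finite U ->
  corr (f * g) [:: U] = corr f [:: U] * g + f * corr g [:: U].
Proof.
move=> Uf.
have Ufg (k : I -> series I K) : locally_finite (fun p => U p * k p) := lfM k Uf.
rewrite [corr f _ * g]mulrC /= !ssumZ // -ssumD; [|exact: lfMl..].
congr ssum; apply/funext => p.
rewrite pderivM mulrDr; congr (_ + _); last exact: mulrCA.
by rewrite mulrA mulrC.
Qed.

Lemma corr_svar q U : corr (svar K q) [:: U] = U q.
Proof.
rewrite /= -[RHS](ssum_delta q U); congr ssum; apply/funext => p.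
by rewrite pderiv_svar mulrC.
Qed.

Lemma corr_cons0 f U Ws : (forall p, corr (pderiv p f) Ws = 0) ->
  corr f (U :: Ws) = 0.
Proof.
move=> e /=; rewrite -[RHS](ssum0 I K).
by congr ssum; apply/funext => p; rewrite e mulr0.
Qed.

Lemma corr_cons_delta f q Ws :
  corr f ((fun p => (p == q)%:R) :: Ws) = corr (pderiv q f) Ws.
Proof. exact: ssum_delta. Qed.

Lemma corr_flat0 f U : (forall p, pderiv p f = 0) -> corr f [:: U] = 0.
Proof. by move=> e; apply: corr_cons0 => p; rewrite e. Qed.

Lemma sum_mulrDl (J : finType) (x y z : J -> series I K) :
  \sum_j (x j + y j) * z j = \sum_j x j * z j + \sum_j y j * z j.
Proof. by rewrite -big_split; apply: eq_bigr => j _; rewrite mulrDl. Qed.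

(** The form in which the right-hand side of the genus-1 recursion gets
    differentiated. *)
Lemma derive_trace (J : finType) (k : K) f U W (Ys : J -> seq (vfield I K)) :
  locally_finite U -> locally_finite W ->
  (forall j, all_vf (@locally_finite I K) (Ys j)) ->
  (forall j, all_vf flat (Ys j)) ->
  corr (k *: \sum_j corr f (W :: Ys j)) [:: U] =
  k *: (\sum_j corr f (nabla U W :: Ys j)) +
  k *: (\sum_j corr f [:: W, U & Ys j]).
Proof.
move=> Uf Wf Yf Yc; rewrite corrZ // corr_sum // -scalerDr -big_split.
by congr (_ *: _); apply: eq_bigr => j _; exact: corr_derive.
Qed.

Lemma pderiv_svarM p x y : pderiv p (svar K x * svar K y) =
  (p == x)%:R * svar K y + (p == y)%:R * svar K x.
Proof.
rewrite pderivM [X in _ + X = _]mulrC.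
exact: (f_equal2 (fun u w => u * svar K y + w * svar K x)
          (pderiv_svar p x) (pderiv_svar p y)).
Qed.

Lemma pderiv_quadratic (J : finType) (v : J -> I) (B : J -> J -> K) p :
  (forall a b, B a b = B b a) ->
  pderiv p (\sum_a \sum_b B a b *: (svar K (v a) * svar K (v b))) =
  2 *: \sum_a (p == v a)%:R * \sum_b B a b *: svar K (v b).
Proof.
move=> Bs; pose G a b := B a b *: ((p == v a)%:R * svar K (v b)).
transitivity (\sum_a \sum_b (G a b + G b a)).
  rewrite pderiv_sum; apply: eq_bigr => a _.
  rewrite pderiv_sum; apply: eq_bigr => b _.
  by rewrite pderivZ pderiv_svarM scalerDr /G (Bs b a).
have -> : \sum_a \sum_b (G a b + G b a) = 2 *: \sum_a \sum_b G a b.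
  under eq_bigr do rewrite big_split.
  by rewrite big_split /= [X in _ + X]exchange_big -mulr2n scaler_nat.
congr (_ *: _); apply: eq_bigr => a _; rewrite mulr_sumr.
by apply: eq_bigr => b _; exact: scalerAr.
Qed.

End Brackets.

(** * The numerical coefficients *)

(** [P], [M], [N], [L], [Z] stand for the five tensors of A_1(W), and the
    hypotheses list the values of the thirteen terms of A_2(S, T(W)). *)
Lemma A2_combination (I : choiceType) (K : numFieldType)
    (x1 x2 x3 x4 x5 x6 x7 x8 x9 x10 x11 x12 x13 P M N L Z : series I K) :
  x1 = P -> x2 = 0 -> x3 = P + 24^-1 *: L -> x4 = 0 -> x5 = L -> x6 = 0 ->
  x7 = 0 -> x8 = N -> x9 = M -> x10 = 2 *: M + L + 24^-1 *: Z -> x11 = 0 ->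
  x12 = 0 -> x13 = Z ->
  (13 / 10) *: x1 + (4 / 5) *: x2 + (4 / 5) *: x3 - (4 / 5) *: x4
  + (23 / 240) *: x5 + (1 / 48) *: x6 + (1 / 48) *: x7 - (1 / 80) *: x8
  + (7 / 30) *: x9 + (1 / 30) *: x10 + (1 / 30) *: x11 - (1 / 30) *: x12
  + (1 / 576) *: x13 =
  3 *: ((7 / 10) *: P + (1 / 10) *: M - (1 / 240) *: N + (13 / 240) *: L
        + (1 / 960) *: Z).
Proof.
do 13!(move=> ->); rewrite !scaler0 !addr0 !subr0; apply/seriesP => a.
by rewrite /=; field; rewrite ?pnatr_eq0.
Qed.

Lemma dilaton_cancel (I : choiceType) (K : numFieldType) (x u v w : series I K) :
  x - 3 *: v = 3 *: w -> x = 3 *: u -> v = 0 -> u = w.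
Proof.
have three : (3 : K) != 0 by rewrite pnatr_eq0.
move=> e xu v0; move: e; rewrite xu v0 scaler0 subr0.
by move=> /(congr1 (fun f => 3^-1 *: f)); rewrite !scalerA mulVf // !scale1r.
Qed.

(** * Fields on the big phase space *)

Section BigPhaseSpaceRules.
Variables (R : realType) (n : nat).
Local Notation C := (R[i]).
Local Notation idx := (nat * 'I_n.+1)%type.
Local Notation vf := (vfield idx C).
Variables (eta : 'M[C]_n.+1) (F : nat -> series idx C).
Implicit Types (U V W X Y : vf) (Ys : seq vf) (a b : 'I_n.+1) (p q : idx).
Implicit Types (f g : series idx C).

Local Notation "'<<' x ; .. ; y '>>_' g" :=
  (corr (F g) (@cons vf x .. (@cons vf y (@nil vf)) ..))
  (at level 0, x at level 99, y at level 99, g at level 2).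
Local Notation lf := (@locally_finite idx C).
Local Notation S := (@string_vf R n).
Local Notation Dil := (@dilaton_vf R n).
Local Notation gam := (@gam R n).
Local Notation gamup := (@gamup R n eta).
Local Notation qprod := (@qprod R n eta F).
Local Notation T := (@T R n eta F).

Definition primary Y := forall p, p.1 != 0%N -> Y p = 0.

(** Lowers descendant levels, tau_(m+1) to tau_m, and kills the primary part;
    it is minus the derivative of the string field along [X]. *)
Definition unshift X : vf := fun p => X (p.1.+1, p.2).

Lemma gamupE a p : gamup a p = \sum_b (invmx eta a b)%:A * gam b p.
Proof.
rewrite /Defs.gamup fct_sumE; apply: eq_bigr => b _.
exact/esym/mulr_algl.
Qed.

Lemma lf_gam a : lf (gam a).
Proof.
have := @lf_delta _ C (0%N, a) 1; congr locally_finite.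
by apply/funext => p; rewrite mulr1.
Qed.

Lemma lf_gamup a : lf (gamup a).
Proof.
have -> : gamup a = fun p => \sum_b (invmx eta a b)%:A * gam b p.
  by apply/funext => p; exact: gamupE.
by apply: lf_sum => b; apply: lfMl; exact: lf_gam.
Qed.

Lemma flat_gam a : flat (gam a).
Proof. by move=> q p; exact: pderiv_nat. Qed.

Lemma flat_gamup a : flat (gamup a).
Proof.
move=> q p; rewrite gamupE pderiv_sum big1 // => b _.
by rewrite mulr_algl pderivZ flat_gam scaler0.
Qed.

Lemma primary_gam a : primary (gam a).
Proof.
move=> [m b] /= m0; rewrite /Defs.gam /tau; case: eqP => // -[e].
by rewrite e in m0.
Qed.

Lemma primary_lincomb (h : 'I_n.+1 -> series idx C) :
  primary (fun p => \sum_a h a * gam a p).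
Proof. by move=> p p0; rewrite big1 // => a _; rewrite primary_gam ?mulr0. Qed.

Lemma primary_gamup a : primary (gamup a).
Proof. by move=> p p0; rewrite gamupE; exact: primary_lincomb p0. Qed.

Lemma lf_lincomb (h : 'I_n.+1 -> series idx C) :
  lf (fun p => \sum_a h a * gam a p).
Proof. by apply: lf_sum => a; apply: lfMl; exact: lf_gam. Qed.

Lemma lf_qprod U W : lf (qprod U W). Proof. exact: lf_lincomb. Qed.

Lemma primary_qprod U W : primary (qprod U W).
Proof. exact: primary_lincomb. Qed.

Lemma lf_unshift W : lf W -> lf (unshift W).
Proof.
move=> Wf; apply: supported_lf => a; have [D _ WD] := lf_supported Wf a.
exists [seq (q.1.-1, q.2) | q <- D] => -[m c] b ba pD.
by apply: WD => //; apply: contra pD => pD; apply/mapP; exists (m.+1, c).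
Qed.

Lemma lf_tau_shift W : lf W -> lf (tau_shift W).
Proof.
move=> Wf; apply: supported_lf => a; have [D _ WD] := lf_supported Wf a.
exists [seq (q.1.+1, q.2) | q <- D] => -[[|m] c] b ba pD //.
by apply: WD => //; apply: contra pD => pD; apply/mapP; exists (m, c).
Qed.

Lemma lf_T W : lf W -> lf (T W).
Proof.
by move=> Wf; apply: lfD (lf_tau_shift Wf) (lfN _); exact: lf_lincomb.
Qed.

(** The correction term of [T W] is primary, hence invisible to lowering. *)
Lemma unshift_T W : unshift (T W) = W.
Proof.
apply/funext => -[m a]; rewrite /unshift /Defs.T /=.
by rewrite (primary_lincomb (fun c => << W; gamup c >>_0)) // subr0.
Qed.

Lemma lf_dilaton : lf Dil.
Proof.
apply: lfN; apply: lfD.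
  apply: supported_lf => a; exists a => p b /msubsetP ba pa /=.
  case: eqP => // e; move: (ba p); rewrite e msetnE eqxx leqNgt ltnS.
  by rewrite leqn0 mset_eq0 (negPf pa).
apply: lfN; apply: supported_lf => a; exists [:: (1%N, ord0)] => p b _.
by rewrite inE => /negPf ->.
Qed.

(** The string field is the lowering of the dilaton field by definition, so its
    derivatives come for free. *)
Lemma lf_string : lf S. Proof. exact: lf_unshift lf_dilaton. Qed.

Lemma pderiv_dilaton q p : pderiv q (Dil p) = - (q == p)%:R :> series idx C.
Proof.
by rewrite /dilaton_vf /ttilde pderivN pderivD pderivN pderiv_nat subr0 pderiv_svar.
Qed.

Lemma flat_pderiv_dilaton q : flat (fun p => pderiv q (Dil p)).
Proof. by move=> r p; rewrite pderiv_dilaton pderivN pderiv_nat oppr0. Qed.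

(** The components of the dilaton field are minus the coordinates, up to a
    constant. *)
Lemma nabla_dilaton X : nabla X Dil = fun p => - X p.
Proof.
apply/funext => p; rewrite /nabla /=.
rewrite -[RHS](ssum_delta p (fun q => - X q)); congr ssum; apply/funext => q.
by rewrite pderiv_dilaton mulrN mulrC mulrN.
Qed.

Lemma nabla_string X : nabla X S = fun p => - unshift X p.
Proof.
apply/funext => p; exact: (congr1 (fun V : vf => V (p.1.+1, p.2)) (nabla_dilaton X)).
Qed.

(** The string field is constant along primary directions. *)
Lemma string_primary f Ys : all_vf lf Ys -> all_vf primary Ys ->
  corr f (S :: Ys) = corr (corr f [:: S]) Ys.
Proof.
move=> Ysf Ysp; rewrite corr_affine //.
- exact: lf_string.
- by move=> q r p; exact: flat_pderiv_dilaton.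
elim: Ys Ysp {Ysf} => //= Y Ys IH [Yp /IH]; split=> //.
by rewrite nabla_string; apply/funext => p; rewrite /unshift Yp ?oppr0.
Qed.

Lemma string_cons f X Ys : lf X -> all_vf lf Ys -> all_vf primary Ys ->
  corr f [:: S, X & Ys] = corr (corr f [:: S]) (X :: Ys) + corr f (unshift X :: Ys).
Proof.
move=> Xf Ysf Ysp; rewrite corr_affine_cons //.
- by rewrite nabla_string (corrNl f Ys (lf_unshift Xf)) subrK.
- exact: lf_string.
- by move=> q r p; exact: flat_pderiv_dilaton.
by move=> g; rewrite -string_primary.
Qed.

Lemma corr_gamup f a Ys :
  corr f (gamup a :: Ys) = \sum_b invmx eta a b *: corr f (gam b :: Ys).
Proof.
have -> : gamup a = fun p => \sum_b (invmx eta a b)%:A * gam b p.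
  by apply/funext => p; exact: gamupE.
rewrite corr_lincomb; last exact: lf_gam.
by apply: eq_bigr => b _; rewrite mulr_algl.
Qed.

Lemma corr_qprod f U W Ys :
  corr f (qprod U W :: Ys) = \sum_a << U; W; gamup a >>_0 * corr f (gam a :: Ys).
Proof. by rewrite corr_lincomb //; exact: lf_gam. Qed.

Local Opaque corr svar pderiv ssum.

Lemma corr_gam f a : corr f [:: gam a] = pderiv (0%N, a) f.
Proof. exact: corr_cons_delta. Qed.

Lemma nabla_lincomb U (h : 'I_n.+1 -> series idx C) : lf U ->
  nabla U (fun p => \sum_a h a * gam a p) =
  fun p => \sum_a corr (h a) [:: U] * gam a p.
Proof.
move=> Uf; apply/funext => p; rewrite /nabla corr_sum //.
apply: eq_bigr => a _; rewrite corrM // [X in _ + _ * X](_ : _ = 0) ?mulr0 ?addr0 //.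
by apply: corr_flat0 => q; exact: flat_gam.
Qed.

(** Up to sign, the quantum product by [U] is the derivative of the operator
    [T] along [U]. *)
Lemma nabla_T U W : lf U -> lf W ->
  nabla U (T W) = fun p => T (nabla U W) p - qprod W U p.
Proof.
move=> Uf Wf; apply/funext => p.
pose h a := << W; gamup a >>_0.
rewrite /nabla -[T W p]/(tau_shift W p - \sum_a h a * gam a p).
rewrite corrD // -scaleN1r corrZ // scaleN1r.
have := congr1 (fun V : vf => V p) (nabla_lincomb h Uf); rewrite /nabla => ->.
rewrite /Defs.T /Defs.qprod -addrA -opprD; congr (_ - _).
  by case: p => [[|m] b]; rewrite /tau_shift //= corr0.
apply: etrans (sum_mulrDl _ _ _); apply: eq_bigr => a _.
apply: (congr1 (fun x => x * gam a p)).
rewrite corr_derive //; split=> //; [exact: lf_gamup | exact: flat_gamup].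
Qed.

Lemma nabla_qprod V W U : lf V -> lf W -> lf U -> flat U ->
  nabla V (qprod W U) =
  fun p => qprod (nabla V W) U p + \sum_a << W; V; U; gamup a >>_0 * gam a p.
Proof.
move=> Vf Wf Uf Uc; rewrite nabla_lincomb //; apply/funext => p.
apply: etrans (sum_mulrDl _ _ _); apply: eq_bigr => a _.
apply: (congr1 (fun x => x * gam a p)).
by rewrite corr_derive //; do !split=> //; [exact: lf_gamup | exact: flat_gamup].
Qed.

Lemma qprodC U V : lf U -> lf V -> qprod U V = qprod V U.
Proof.
move=> Uf Vf; apply/funext => p; apply: eq_bigr => a _.
by rewrite corr_swap.
Qed.

(** * Consequences of the string equation *)

Hypotheses (eta_sym : eta^T = eta) (eta_unit : eta \in unitmx).

Lemma invmx_sym a b : invmx eta a b = invmx eta b a.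
Proof. by rewrite -{1}eta_sym -trmx_inv mxE. Qed.

(** The contraction over a pair of dual bases does not depend on which member
    of each pair sits where; this is the symmetry of the inverse pairing. *)
Lemma trace_gam (A B : vf -> series idx C) :
  (forall a, A (gamup a) = \sum_b invmx eta a b *: A (gam b)) ->
  (forall a, B (gamup a) = \sum_b invmx eta a b *: B (gam b)) ->
  \sum_a A (gamup a) * B (gam a) = \sum_a A (gam a) * B (gamup a).
Proof.
move=> HA HB; under eq_bigr do rewrite HA mulr_suml.
rewrite exchange_big; apply: eq_bigr => b _; rewrite HB mulr_sumr.
by apply: eq_bigr => a _; rewrite invmx_sym -scalerAl scalerAr.
Qed.

Hypothesis F_string : forall g : nat, string_eq eta F g.

Lemma eta_symE a b : eta a b = eta b a.
Proof. by rewrite -{1}eta_sym mxE. Qed.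

Lemma pderiv_string0 p : pderiv p << S >>_0 =
  \sum_a (p == (0%N, a))%:R * \sum_b eta a b *: svar C (0%N, b).
Proof.
have two : (2 : C) != 0 by rewrite pnatr_eq0.
rewrite (F_string 0) eqxx pderivZ.
by rewrite (pderiv_quadratic (pair 0%N) _ eta_symE) scalerA mulVf // scale1r.
Qed.

(** In genus 0 the series <<S>> is quadratic. *)
Lemma pderiv3_string0 p q r : pderiv r (pderiv q (pderiv p << S >>_0)) = 0.
Proof.
rewrite pderiv_string0 !pderiv_sum big1 // => a _.
rewrite pderivM pderiv_nat mul0r add0r pderivM pderiv_nat mul0r add0r.
rewrite !pderiv_sum big1 ?mulr0 // => b _.
by rewrite !pderivZ pderiv_svar pderiv_nat scaler0.
Qed.

Lemma corr3_string0 U V W Ys : corr << S >>_0 [:: U, V, W & Ys] = 0.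
Proof.
do 3!(apply: corr_cons0 => ?).
by rewrite pderiv3_string0 corr0.
Qed.

(** Raising an index of the pairing cancels it, leaving the coordinate t^a_0. *)
Lemma string0_gamup a : corr << S >>_0 [:: gamup a] = svar C (0%N, a).
Proof.
have E b : \sum_c invmx eta a c * eta c b = (a == b)%:R.
  by have := congr1 (fun A : 'M_n.+1 => A a b) (mulVmx eta_unit); rewrite !mxE.
rewrite corr_gamup.
transitivity (\sum_c \sum_b (invmx eta a c * eta c b) *: svar C (0%N, b)).
  apply: eq_bigr => c _; rewrite corr_gam pderiv_string0.
  under [RHS]eq_bigr do rewrite -scalerA; rewrite -scaler_sumr; congr (_ *: _).
  rewrite (bigD1 c) //= eqxx mul1r addrC big1 ?add0r // => b bc.
  by rewrite xpair_eqE eq_sym (negPf bc) andbF mul0r.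
transitivity (\sum_b (a == b)%:R *: svar C (0%N, b)).
  by rewrite exchange_big; apply: eq_bigr => b _; rewrite -scaler_suml E.
rewrite (bigD1 a) //= big1 => [|b ba].
  by rewrite eqxx scale1r addr0.
by rewrite eq_sym (negPf ba) scale0r.
Qed.

Lemma string0_gamup_cons a U : lf U -> primary U -> << S; gamup a; U >>_0 = U (0%N, a).
Proof.
move=> Uf Up; have af := lf_gamup a; have ap := @primary_gamup a.
have ac : flat (gamup a) by exact: flat_gamup.
rewrite string_primary // -(@corr_flat _ _ << S >>_0 _ [:: U] af ac) //.
by rewrite string0_gamup corr_svar.
Qed.

(** The string field restricts to the unit of the quantum product on primary
    fields, since <<U S gamma^a>>_0 is the derivative of t^a_0 along [U]. *)
Lemma qprod_string U : lf U -> primary U -> qprod U S = U.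
Proof.
move=> Uf Up; have Sf := lf_string.
have e a : << U; S; gamup a >>_0 = U (0%N, a).
  have af := lf_gamup a; rewrite corr_swap //.
  by rewrite (corr_cons _ _ (fun g => corr_swap g [::] Uf af)) string0_gamup_cons.
apply/funext => p; transitivity (\sum_a U (0%N, a) * gam a p).
  by apply: eq_bigr => a _; rewrite e.
have [p0|p0] := eqVneq p.1 0%N; last by rewrite primary_lincomb // Up.
rewrite (bigD1 p.2) //= big1 ?addr0 => [|a ap].
  by case: p p0 => m b /= ->; rewrite /Defs.gam /tau eqxx mulr1.
rewrite /Defs.gam /tau; case: eqP => [pE|]; last by rewrite mulr0.
by rewrite pE eqxx in ap.
Qed.

(** Raising levels in S recovers all of the dilaton field except its primary
    part, which comes from <<S gamma^a>>_0 = t^a_0. *)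
Lemma T_string : T S = Dil.
Proof.
have e a : << S; gamup a >>_0 = svar C (0%N, a).
  have af := lf_gamup a; have ap := @primary_gamup a.
  by rewrite string_primary // string0_gamup.
apply/funext => -[m b].
transitivity (tau_shift S (m, b) - \sum_a svar C (0%N, a) * gam a (m, b)).
  by congr (_ - _); apply: eq_bigr => a _; rewrite e.
case: m => [|m]; last first.
  by rewrite (primary_lincomb (fun a => svar C (0%N, a))) // subr0.
rewrite /tau_shift /= sub0r /dilaton_vf /ttilde subr0; congr (- _).
rewrite (bigD1 b) //= big1 ?addr0 => [|a ab].
  by rewrite /Defs.gam /tau eqxx mulr1.
by rewrite /Defs.gam /tau xpair_eqE eq_sym (negPf ab) andbF mulr0.
Qed.

(** With two further entries the quadratic term of the genus-0 string equation
    has been differentiated away. *)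
Lemma string0_unshift X U V Ys : lf X -> all_vf lf [:: U, V & Ys] ->
  all_vf primary [:: U, V & Ys] ->
  corr (F 0) [:: S, X, U, V & Ys] = corr (F 0) [:: unshift X, U, V & Ys].
Proof. by move=> Xf Yf Yp; rewrite string_cons // corr3_string0 add0r. Qed.

Lemma string0_primary U V W Ys : all_vf lf [:: U, V, W & Ys] ->
  all_vf primary [:: U, V, W & Ys] -> corr (F 0) [:: S, U, V, W & Ys] = 0.
Proof. by move=> Yf Yp; rewrite string_primary // corr3_string0. Qed.

Lemma string_pos k : << S >>_(k.+1) = 0. Proof. exact: F_string. Qed.

Lemma stringS_unshift k X Ys : lf X -> all_vf lf Ys -> all_vf primary Ys ->
  corr (F k.+1) [:: S, X & Ys] = corr (F k.+1) (unshift X :: Ys).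
Proof. by move=> Xf Yf Yp; rewrite string_cons // string_pos corr0 add0r. Qed.

Lemma stringS_primary k Ys : all_vf lf Ys -> all_vf primary Ys ->
  corr (F k.+1) (S :: Ys) = 0.
Proof. by move=> Yf Yp; rewrite string_primary // string_pos corr0. Qed.

(** * Dilaton equation and genus-1 recursion *)

Hypothesis F_dilaton : forall g : nat, dilaton_eq F g.

(** The factor is 2g - 2 from the dilaton equation, plus 1 from differentiating
    the components of D. *)
Lemma dilaton2 Y : lf Y -> << Dil; Y >>_2 = 3 *: << Y >>_2.
Proof.
move=> Yf; have Df := lf_dilaton.
have := @corr_affine_cons _ _ (F 2) Dil Y [::] Df Yf flat_pderiv_dilaton I
  (fun=> erefl).
have -> : << Dil >>_2 = 2 *: F 2.
  rewrite (F_dilaton 2) addr0; congr (_ *: _).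
  by rewrite -[(2 * 2)%N]/(2 + 2)%N natrD addrK.
rewrite corrZ // nabla_dilaton (corrNl (F 2) [::] Yf) => e.
apply: (addIr (- << Y >>_2)); rewrite -e -[X in _ = _ - X]scale1r -scalerBl.
by rewrite -[3%:R]/((2 + 1)%:R) natrD addrK.
Qed.

Hypothesis F_trr0 : trr0 eta F.
Hypothesis F_trr1 : trr1 eta F.

(** Differentiate the genus-1 recursion along [U].  Derivatives of the
    components of [W] occur on both sides through the recursion for
    [nabla U W], and cancel. *)
Lemma trr1_deriv1 W U : lf W -> lf U -> flat U ->
  << T W; U >>_1 = << qprod W U >>_1 +
    24^-1 *: \sum_a << W; U; gamup a; gam a >>_0.
Proof.
move=> Wf Uf Uc; have dWf := lf_nabla Uf Wf.
have Tf := lf_T Wf; have qf := lf_qprod W U.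
have dTf := lf_T dWf.
have L := @corr_derive _ _ (F 1) U (T W) [::] Uf Tf I I.
have E : << nabla U (T W) >>_1 = << T (nabla U W) >>_1 - << qprod W U >>_1.
  rewrite (nabla_T Uf Wf) (corrDl (F 1) [::] dTf (lfN qf)).
  by rewrite (corrNl (F 1) [::] qf).
have TU := @derive_trace _ _ _ 24^-1 (F 0) U W (fun a => [:: gamup a; gam a]) Uf Wf
  (fun a => conj (lf_gamup a) (conj (lf_gam a) I))
  (fun a => conj (@flat_gamup a) (conj (@flat_gam a) I)).
rewrite (F_trr1 Wf) TU in L.
move: L; rewrite E -(F_trr1 dWf) -addrA => /addrI ->.
by rewrite addNKr.
Qed.

(** A second differentiation; again the terms with [nabla V W] cancel, this
    time by [trr1_deriv1]. *)
Lemma trr1_deriv2 W U V : lf W -> lf U -> flat U -> lf V -> flat V ->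
  << T W; V; U >>_1 = << qprod W V; U >>_1 + << qprod W U; V >>_1 +
    \sum_a << W; V; U; gamup a >>_0 * << gam a >>_1 +
    24^-1 *: \sum_a << W; V; U; gamup a; gam a >>_0.
Proof.
move=> Wf Uf Uc Vf Vc; have dWf := lf_nabla Vf Wf.
have Tf := lf_T Wf; have dTf := lf_T dWf.
have qf U' := lf_qprod W U'.
have dqf := lf_qprod (nabla V W) U.
have L := @corr_derive _ _ (F 1) V (T W) [:: U] Vf Tf (conj Uf I) (conj Uc I).
have E : << nabla V (T W); U >>_1 = << T (nabla V W); U >>_1 - << qprod W V; U >>_1.
  rewrite (nabla_T Vf Wf) (corrDl (F 1) [:: U] dTf (lfN (qf V))).
  by rewrite (corrNl (F 1) [:: U] (qf V)).
have Q := @corr_derive _ _ (F 1) V (qprod W U) [::] Vf (qf U) I I.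
have EQ : << nabla V (qprod W U) >>_1 = << qprod (nabla V W) U >>_1 +
    \sum_a << W; V; U; gamup a >>_0 * << gam a >>_1.
  rewrite (nabla_qprod Vf Wf Uf Uc) (corrDl (F 1) [::] dqf (lf_lincomb _)).
  by apply: congr1; apply: corr_lincomb; exact: lf_gam.
have e := corrD << qprod W U >>_1 (24^-1 *: \sum_a << W; U; gamup a; gam a >>_0)
  (conj Vf I : all_vf lf [:: V]).
rewrite -(trr1_deriv1 Wf Uf Uc) {}L {}E {}Q {}EQ (trr1_deriv1 dWf Uf Uc) in e.
have TV := @derive_trace _ _ _ 24^-1 (F 0) V W (fun a => [:: U; gamup a; gam a]) Vf Wf
  (fun a => conj Uf (conj (lf_gamup a) (conj (lf_gam a) I)))
  (fun a => conj Uc (conj (@flat_gamup a) (conj (@flat_gam a) I))).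
rewrite {}TV in e.
move: e; set A := << qprod (nabla V W) U >>_1; set B := << qprod W V; U >>_1.
set c := _ *: _; set D := << T W; V; U >>_1.
(* [A + c] is the contribution of [nabla V W] common to both sides. *)
by move=> e; apply: (addrI (A + c - B)); rewrite e; ring.
Qed.

(** * Contraction with the string field *)

(** In terms 1, 5, 9 and 13 of A_2 the string field meets [T W] in a genus-0
    bracket, in term 8 in a genus-1 bracket, and lowers it to [W].  In terms 3
    and 10 it acts as a unit, and the differentiated genus-1 recursion applies
    to what is left.  The other terms contain either a product with [T W] or a
    vanishing bracket of S with primary fields only. *)
Lemma A2_string_T W : lf W -> A2 eta F S (T W) = 3 *: A1 eta F W.
Proof.
move=> Wf; set X := T W.
have Sf : lf S := lf_string.
have Xf : lf X := lf_T Wf.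
have gf a : lf (gam a) := lf_gam a.
have uf a : lf (gamup a) := lf_gamup a.
have gp a : primary (gam a) := @primary_gam a.
have up a : primary (gamup a) := @primary_gamup a.
have qf U V : lf (qprod U V) := lf_qprod U V.
have qp U V : primary (qprod U V) := @primary_qprod U V.
have SX : unshift X = W := unshift_T W.
have qX0 U Ys : lf U -> forall f, corr f (qprod U X :: Ys) = 0.
  move=> Uf f; rewrite (qprodC Uf Xf) (F_trr0 Wf Uf); exact: corr_0l.
have qS U : lf U -> primary U -> qprod U S = U.
  exact: qprod_string.
have s0 U V Ys : all_vf lf [:: U, V & Ys] -> all_vf primary [:: U, V & Ys] ->
    corr (F 0) [:: S, X, U, V & Ys] = corr (F 0) [:: W, U, V & Ys].
  by move=> Yf Yp; rewrite (string0_unshift Xf Yf Yp) SX.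
pose P : series idx C := \sum_a << gam a >>_1 * << qprod (gamup a) W >>_1.
pose M : series idx C := \sum_a << gam a; qprod (gamup a) W >>_1.
pose N : series idx C := \sum_a << W; qprod (gam a) (gamup a) >>_1.
pose L : series idx C := \sum_a \sum_b
  << W; gam a; gamup a; gamup b >>_0 * << gam b >>_1.
pose Z : series idx C := \sum_a \sum_b << W; gamup a; gam a; gamup b; gam b >>_0.
have t1 : \sum_a \sum_b
    << S; X; gamup a; gamup b >>_0 * << gam a >>_1 * << gam b >>_1 = P.
  apply: eq_bigr => a _; rewrite (qprodC (uf a) Wf).
  rewrite corr_qprod mulr_sumr; apply: eq_bigr => b _.
  rewrite s0; [|by []..].
  by rewrite [RHS]mulrCA mulrA.
have t2 : \sum_a << S; gamup a >>_1 * << qprod (gam a) X >>_1 = 0.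
  by rewrite big1 // => a _; rewrite (qX0 _ _ (gf a)) mulr0.
have t3 : \sum_a << X; gamup a >>_1 * << qprod (gam a) S >>_1 = P + 24^-1 *: L.
  transitivity (\sum_a (<< gam a >>_1 * << qprod (gamup a) W >>_1 +
     24^-1 *: \sum_b << W; gam b; gamup b; gamup a >>_0 * << gam a >>_1)).
    apply: eq_bigr => a _; rewrite (qS _ (gf a) (gp a)).
    rewrite (trr1_deriv1 Wf (uf a) (@flat_gamup a)).
    rewrite (qprodC (uf a) Wf) mulrDl [X in _ = X + _]mulrC.
    rewrite -scalerAl mulr_suml.
    apply: congr1; apply: congr1; apply: eq_bigr => b _.
    apply: (congr1 (fun x => x * << gam a >>_1)).
    by apply: corr_cons => g; exact: corr_rev3.
  by rewrite big_split -scaler_sumr exchange_big.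
have t4 : \sum_a << qprod S X; gamup a >>_1 * << gam a >>_1 = 0.
  by rewrite big1 // => a _; rewrite (qX0 _ _ Sf) mul0r.
have t5 : \sum_a \sum_b
    << S; X; gamup a; gam a; gamup b >>_0 * << gam b >>_1 = L.
  apply: eq_bigr => a _; apply: eq_bigr => b _.
  apply: (congr1 (fun x => x * << gam b >>_1)).
  rewrite s0; [|by []..].
  by apply: corr_cons => g; exact: corr_swap.
have t6 : \sum_a \sum_b
    << S; gamup a; gam a; gamup b >>_0 * << gam b; X >>_1 = 0.
  rewrite big1 // => a _; rewrite big1 // => b _.
  rewrite string0_primary; [exact: mul0r|by []..].
have t7 : \sum_a \sum_b
    << X; gamup a; gam a; gamup b >>_0 * << gam b; S >>_1 = 0.
  rewrite big1 // => a _; rewrite big1 // => b _.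
  rewrite (corr_swap (F 1) [::] (gf b) Sf).
  rewrite stringS_primary; [exact: mulr0|by []..].
have t8 : \sum_a << S; X; qprod (gamup a) (gam a) >>_1 = N.
  apply: eq_bigr => a _; rewrite (qprodC (uf a) (gf a)).
  rewrite stringS_unshift; [by rewrite SX|by []..].
have t9 : \sum_a \sum_b << S; X; gamup a; gamup b >>_0 * << gam a; gam b >>_1 = M.
  apply: eq_bigr => a _; rewrite (qprodC (uf a) Wf).
  rewrite (corr_swap (F 1) [::] (gf a) (qf _ _)) corr_qprod; apply: eq_bigr => b _.
  rewrite s0; [|by []..].
  by apply: congr1; exact: corr_swap.
have t10 : \sum_a << gam a; qprod (gamup a) S; X >>_1 =
    2 *: M + L + 24^-1 *: Z.
  have M1 : \sum_a << qprod W (gamup a); gam a >>_1 = M.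
    apply: eq_bigr => a _; rewrite (qprodC Wf (uf a)).
    exact: corr_swap.
  (* Expand both products in the basis; the two contractions then differ only
     in which member of each dual pair is raised. *)
  have M2 : \sum_a << qprod W (gam a); gamup a >>_1 = M.
    rewrite -M1; pose A b V := << W; V; gamup b >>_0; pose B b V := << gam b; V >>_1.
    transitivity (\sum_b \sum_a A b (gam a) * B b (gamup a)).
      by rewrite exchange_big; apply: eq_bigr => a _; exact: corr_qprod.
    transitivity (\sum_b \sum_a A b (gamup a) * B b (gam a)); last first.
      by rewrite exchange_big; apply: eq_bigr => a _; apply/esym; exact: corr_qprod.
    apply: eq_bigr => b _; apply/esym/(trace_gam (A := A b) (B := B b)) => a.
      rewrite /A (corr_swap _ _ Wf (uf a)) corr_gamup; apply: eq_bigr => c _.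
      by apply: congr1; exact: corr_swap.
    rewrite /B (corr_swap _ _ (gf b) (uf a)) corr_gamup; apply: eq_bigr => c _.
    by apply: congr1; exact: corr_swap.
  transitivity (\sum_a (<< qprod W (gamup a); gam a >>_1 +
     << qprod W (gam a); gamup a >>_1 +
     \sum_b << W; gam a; gamup a; gamup b >>_0 * << gam b >>_1 +
     24^-1 *: \sum_b << W; gamup a; gam a; gamup b; gam b >>_0)).
    apply: eq_bigr => a _; rewrite (qS _ (uf a) (up a)).
    rewrite (corr_rev3 (F 1) [::] (gf a) (uf a) Xf).
    rewrite (trr1_deriv2 Wf (gf a) (@flat_gam a) (uf a)
      (@flat_gamup a)).
    apply: (congr1 (fun x => _ + x + _)); apply: eq_bigr => b _.
    apply: (congr1 (fun x => x * << gam b >>_1)).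
    by apply: corr_cons => g; exact: corr_swap.
  rewrite !big_split -scaler_sumr /= M1 M2.
  by rewrite -[M + M]mulr2n -scaler_nat.
have t11 : \sum_a << gam a; qprod (gamup a) X; S >>_1 = 0.
  by rewrite big1 // => a _; rewrite (corr_swap _ _ (gf a) (qf _ _)) (qX0 _ _ (uf a)).
have t12 : \sum_a << qprod S X; gam a; gamup a >>_1 = 0.
  by rewrite big1 // => a _; rewrite (qX0 _ _ Sf).
have t13 : \sum_a \sum_b << S; X; gamup a; gam a; gamup b; gam b >>_0 = Z.
  apply: eq_bigr => a _; apply: eq_bigr => b _.
  by apply: s0.
exact: (A2_combination t1 t2 t3 t4 t5 t6 t7 t8 t9 t10 t11 t12 t13).
Qed.

(** The second bracket of (II) drops out since S . T(W) = 0, and the first is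
    3 <<T(T(W))>>_2, so both sides can be divided by 3. *)
Lemma trr2_TT_imp_T2 : trr2_TT eta F -> trr2_T2 eta F.
Proof.
move=> TT W Wf; have Xf := lf_T Wf; have Sf := lf_string.
have T0 : << T (qprod S (T W)) >>_2 = 0.
  rewrite (qprodC Sf Xf) (F_trr0 Wf Sf).
  have -> : T 0 = fun=> 0.
    apply/funext => -[m b]; rewrite /Defs.T big1 ?subr0 => [|a _].
      by case: m.
    by rewrite corr_0l mul0r.
  exact: corr_0l.
have TS : << T S; T (T W) >>_2 = 3 *: << T (T W) >>_2.
  by rewrite T_string; exact: (dilaton2 (lf_T Xf)).
have e := TT S (T W) Sf Xf; rewrite (A2_string_T Wf) in e.
exact: (dilaton_cancel e TS T0).
Qed.

End BigPhaseSpaceRules.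

Theorem theorem2p6 (R : realType) (n : nat) (eta : 'M[R[i]]_n.+1)
    (F : nat -> series (nat * 'I_n.+1)%type R[i])
    (eta_sym : eta^T = eta) (eta_unit : eta \in unitmx)
    (F_string : forall g : nat, string_eq eta F g)
    (F_dilaton : forall g : nat, dilaton_eq F g)
    (F_trr0 : trr0 eta F) (F_trr1 : trr1 eta F) :
  trr2_TT eta F -> trr2_T2 eta F.
Proof. exact: trr2_TT_imp_T2. Qed.
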